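(* If $\mathcal{B}$ is a right-sided reproducing kernel Banach space of functions on $\Omega$ with the right-sided reproducing kernel $K\in L_0(\Omega\times\Omega')$ such that the map $x\mapsto K(x,\cdot)$ (from $\Omega$ to $\mathcal{B}'$ with its norm) is continuous on $\Omega$, then $\mathcal{B}$ is composed of continuous functions, i.e. $\mathcal{B}\subseteq C(\Omega)$.
   Context: $\Omega,\Omega'$ are locally compact Hausdorff spaces equipped with regular Borel measures $\mu,\mu'$. $L_0(X)$ denotes the set of real-valued measurable functions on $X$ (genuine functions). For a Banach space $\mathcal{B}$, $\mathcal{B}'$ is its continuous dual and $\langle f,G\rangle_{\mathcal{B}}:=G(f)$. Right-sided reproducing kernel Banach space: let $K\in L_0(\Omega\times\Omega')$ and let $\mathcal{B}$ be a Banach space consisting of functions in $L_0(\Omega)$ whose dual $\mathcal{B}'$ is isometrically isomorphic to a normed space $\mathcal{F}$ consisting of functions in $L_0(\Omega')$; $\mathcal{F}$ is fixed and identified with $\mathcal{B}'$. $\mathcal{B}$ is a right-sided reproducing kernel Banach space with right-sided reproducing kernel $K$ if $K(x,\cdot)\in\mathcal{F}\cong\mathcal{B}'$ for each $x\in\Omega$, and $\langle f,K(x,\cdot)\rangle_{\mathcal{B}}=f(x)$ for all $f\in\mathcal{B}$ and all $x\in\Omega$. *)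

(* Defs.v *)
From HB Require Import structures.
From mathcomp Require Import all_boot all_order all_algebra.
From mathcomp Require Import all_classical all_reals all_analysis.

Set Implicit Arguments.
Unset Strict Implicit.
Unset Printing Implicit Defensive.

Import Order.TTheory GRing.Theory Num.Theory.
Import numFieldNormedType.Exports.

Local Open Scope classical_set_scope.
Local Open Scope ring_scope.

(* The carrier is that of T, so a function on [borel T] is a function on T and
   one may ask for its continuity.  Measurable structures are pointed in the
   library, whence the [ptopologicalType]. *)
Definition borel (T : ptopologicalType) := g_sigma_algebraType (@open T).

HB.instance Definition _ (T : ptopologicalType) := Measurable.on (borel T).

(* Join of the product topology with the product point, missing upstream. *)
HB.instance Definition _ (S T : ptopologicalType) := Pointed.on (S * T)%type.

(* L_0(T): genuine functions, no quotient by almost-everywhere equality.  For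
   T = Om * Om' this is Borel measurability for the product topology, which is
   implied by measurability for the product of the two Borel sigma-algebras. *)
Definition L0 (R : realType) (T : ptopologicalType) : lmodType R :=
  {mfun borel T >-> R}.

Definition L0_fun (R : realType) (T : ptopologicalType) (f : L0 R T) : T -> R :=
  (f : {mfun borel T >-> R}).

(* Inner regularity on open sets only, as is usual on locally compact spaces
   (Haar measures need not be inner regular on all Borel sets). *)
Definition regular_borel_measure (R : realType) (T : ptopologicalType)
    (mu : {measure set (borel T) -> \bar R}) : Prop :=
  [/\ forall C : set T, compact C -> (mu C < +oo)%E,
      forall A : set (borel T), measurable A ->
        mu A = ereal_inf [set mu U | U in [set U : set T | open U /\ A `<=` U]]
    & forall U : set T, open U ->
        mu U = ereal_sup [set mu C | C in [set C : set T | compact C /\ C `<=` U]]].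

Section Dual.
Context (R : realType) (V : normedModType R).

Definition continuous_linear_form : {pred V -> R^o} :=
  mem [set phi : V -> R^o | linear phi /\ continuous phi].

Record dual := Dual {
  dual_fun :> V -> R^o;
  dual_funP : dual_fun \in continuous_linear_form
}.

HB.instance Definition _ := [isSub for dual_fun].
HB.instance Definition _ := [Choice of dual by <:].

Lemma continuous_linear_form_submod : submod_closed continuous_linear_form.
Proof.
split.
  rewrite inE; split; first by move=> a u v /=; rewrite scaler0 addr0.
  exact: cst_continuous.
move=> a f g /set_mem[lf cf] /set_mem[lg cg]; apply/mem_set; split.
  move=> b u v; rewrite -[LHS]/(a * f (b *: u + v) + g (b *: u + v)).
  rewrite lf lg -[RHS]/(b * (a * f u + g u) + (a * f v + g v)).
  rewrite -[b *: f u]/(b * f u) -[b *: g u]/(b * g u) !mulrDr mulrCA -!addrA.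
  by congr (_ + _); rewrite addrCA.
move=> x; apply: (@cvgD _ R^o); last exact: cg.
by apply: (@cvgZr _ R^o); exact: cf.
Qed.

HB.instance Definition _ := GRing.isSubmodClosed.Build _ _
  continuous_linear_form continuous_linear_form_submod.
HB.instance Definition _ := [SubChoice_isSubLmodule of dual by <:].

Lemma dual_linear (phi : dual) : linear phi.
Proof. by have /set_mem[] := dual_funP phi. Qed.

HB.instance Definition _ (phi : dual) :=
  GRing.isLinear.Build R V R^o *:%R (phi : V -> R^o) (dual_linear phi).

Lemma dual_continuous (phi : dual) : continuous (phi : V -> R^o).
Proof. by have /set_mem[] := dual_funP phi. Qed.

Definition dual_norm (phi : dual) : R :=
  sup [set `|phi f| | f in [set f : V | `|f| <= 1]].

Lemma dual_norm_has_sup (phi : dual) :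
  has_sup [set `|phi f| | f in [set f : V | `|f| <= 1]].
Proof.
split; first by exists `|phi 0|; exists 0 => //=; rewrite normr0.
have /linear_boundedP/pinfty_ex_gt0[M M0 phiM] :=
  @continuous_linear_bounded R V R^o 0 phi (@dual_continuous phi 0).
exists M => _ [f /= f1 <-]; apply: le_trans (phiM f) _.
by rewrite ler_piMr// ltW.
Qed.

Lemma dual_norm_ub (phi : dual) (c : R) :
  (forall f : V, `|f| <= 1 -> `|phi f| <= c) -> dual_norm phi <= c.
Proof.
move=> phic; apply: ge_sup; first by have [] := dual_norm_has_sup phi.
by move=> _ [f f1 <-]; exact: phic.
Qed.

Lemma dual_norm_ge0 (phi : dual) : 0 <= dual_norm phi.
Proof.
apply: le_trans (normr_ge0 (phi 0)) _; apply: sup_upper_bound.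
  exact: dual_norm_has_sup.
by exists 0 => //=; rewrite normr0.
Qed.

Lemma dual_norm_bound (phi : dual) (f : V) :
  `|phi f| <= dual_norm phi * `|f|.
Proof.
have [->|f0] := eqVneq f 0; first by rewrite linear0 !normr0 mulr0.
have nf0 : 0 < `|f| by rewrite normr_gt0.
rewrite -ler_pdivrMr//.
have -> : `|phi f| / `|f| = `|phi (`|f|^-1 *: f)|.
  by rewrite linearZ/= normrZ ger0_norm ?invr_ge0// mulrC.
apply: sup_upper_bound; first exact: dual_norm_has_sup.
exists (`|f|^-1 *: f) => //=.
by rewrite normrZ ger0_norm ?invr_ge0// mulVf// gt_eqF.
Qed.

Lemma dual_normD (phi psi : dual) :
  dual_norm (phi + psi) <= dual_norm phi + dual_norm psi.
Proof.
apply: dual_norm_ub => f f1.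
rewrite -[(phi + psi) f]/(phi f + psi f).
apply: le_trans (ler_normD _ _) _; apply: lerD.
  by apply: le_trans (dual_norm_bound _ _) _; rewrite ler_piMr// dual_norm_ge0.
by apply: le_trans (dual_norm_bound _ _) _; rewrite ler_piMr// dual_norm_ge0.
Qed.

Let dual_normZ_le (a : R) (phi : dual) :
  dual_norm (a *: phi) <= `|a| * dual_norm phi.
Proof.
apply: dual_norm_ub => f f1.
rewrite -[(a *: phi) f]/(a * phi f) normrM ler_wpM2l//.
by apply: le_trans (dual_norm_bound _ _) _; rewrite ler_piMr// dual_norm_ge0.
Qed.

Lemma dual_normZ (a : R) (phi : dual) :
  dual_norm (a *: phi) = `|a| * dual_norm phi.
Proof.
apply/eqP; rewrite eq_le dual_normZ_le/=.
have [->|a0] := eqVneq a 0; first by rewrite normr0 mul0r dual_norm_ge0.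
have na0 : 0 < `|a| by rewrite normr_gt0.
rewrite -ler_pdivlMl// -normfV.
by apply: le_trans (dual_normZ_le _ _); rewrite scalerA mulVf// scale1r.
Qed.

Lemma dual_norm_eq0 (phi : dual) : dual_norm phi = 0 -> phi = 0.
Proof.
move=> phi0; apply/val_inj/funext => f /=.
have := dual_norm_bound phi f.
by rewrite phi0 mul0r normr_le0 => /eqP.
Qed.

HB.instance Definition _ := @Lmodule_isNormed.Build R dual dual_norm
  dual_normD dual_normZ dual_norm_eq0.

End Dual.

Definition pairing (R : realType) (V : normedModType R) (f : V) (G : dual V)
  : R := G f.

Definition isometric_isomorphism (R : realType) (V W : normedModType R)
    (Phi : {linear V -> W}) : Prop :=
  bijective Phi /\ forall v : V, `|Phi v| = `|v|.

(* A normed space V of functions in L_0(T) is a normed module with an injective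
   linear map into L_0(T): its elements are functions on T, with pointwise
   operations, but the norm and topology are its own. *)
Definition function_space (R : realType) (T : ptopologicalType)
    (V : normedModType R) (ev : {linear V -> L0 R T}) : Prop := injective ev.

Section RKBS.
Context (R : realType) (Om Om' : ptopologicalType).
Context (B : completeNormedModType R) (evB : {linear B -> L0 R Om}).
Context (F : normedModType R) (evF : {linear F -> L0 R Om'}).
Context (Phi : {linear F -> dual B}).
Variable K : L0 R (Om * Om')%type.

Definition slice (x : Om) : Om' -> R := fun y => L0_fun K (x, y).

Definition slice_elements (x : Om) : set F :=
  [set g | L0_fun (evF g) = slice x].

(* K(x, .) as a point of B' ~ F; the default value 0 is used only if
   K(x, .) is not in F, which [right_sided_rkbs] excludes. *)
Definition kernel_map (x : Om) : dual B := Phi (xget 0 (slice_elements x)).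

Definition right_sided_rkbs : Prop :=
  [/\ function_space evB,
      function_space evF,
      isometric_isomorphism Phi,
      (forall x : Om, slice_elements x !=set0)
    & (forall (f : B) (x : Om), pairing f (kernel_map x) = L0_fun (evB f) x)].

End RKBS.

(* Main.v *)
Require Import Defs.
From HB Require Import structures.
From mathcomp Require Import all_boot all_order all_algebra.
From mathcomp Require Import all_classical all_reals all_analysis.

Set Implicit Arguments.
Unset Strict Implicit.
Unset Printing Implicit Defensive.

Import Order.TTheory GRing.Theory Num.Theory.
Import numFieldNormedType.Exports.

Local Open Scope classical_set_scope.
Local Open Scope ring_scope.

(** The reproducing property writes each [f] in [B] as a composite: [x] goes to the kernel section
    in [dual B], which is then evaluated at [f]. The first map is continuous by assumption. The
    second, [pairing f], is Lipschitz with constant [|f|] for the dual norm, since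
    [|G f - H f| <= |G - H| * |f|]; this is [pairing_continuous]. *)

Lemma pairing_continuous (R : realType) (V : normedModType R) (f : V) :
  continuous (pairing f : dual V -> R).
Proof.
move=> G; apply/(@cvgrPdist_lt _ _ _ _ (nbhs_filter G)) => e e0; near=> H.
(* The difference of the two pairings is [(G - H) f] by conversion, as operations in [dual V] are
   pointwise. *)
apply: (le_lt_trans (dual_norm_bound (G - H) f)).
(* Enlarging [|f|] to [|f| + 1] allows division even when [f = 0]: it suffices that
   [|G - H| < e / (|f| + 1)]. *)
have f1 : 0 < `|f| + 1 by rewrite ltr_wpDl.
apply: (@le_lt_trans _ _ (`|G - H| * (`|f| + 1))).
  by apply: ler_wpM2l; [exact: dual_norm_ge0 | rewrite lerDl].
rewrite -ltr_pdivlMr//; near: H.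
by apply: cvgr_dist_lt; rewrite ?divr_gt0.
Unshelve. all: by end_near. Qed.

Theorem proposition2p10 (R : realType) (Om Om' : ptopologicalType)
  (hOm : hausdorff_space Om) (lcOm : locally_compact [set: Om])
  (hOm' : hausdorff_space Om') (lcOm' : locally_compact [set: Om'])
  (mu : {measure set (borel Om) -> \bar R}) (rmu : regular_borel_measure mu)
  (mu' : {measure set (borel Om') -> \bar R}) (rmu' : regular_borel_measure mu')
  (K : L0 R (Om * Om')%type)
  (B : completeNormedModType R) (evB : {linear B -> L0 R Om})
  (F : normedModType R) (evF : {linear F -> L0 R Om'})
  (Phi : {linear F -> dual B})
  (rkbs : right_sided_rkbs evB evF Phi K)
  (cK : continuous (kernel_map evF Phi K : Om -> dual B)) :
  forall f : B, continuous (L0_fun (evB f) : Om -> R).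
Proof.
case: rkbs => _ _ _ _ repr f.
(* The reproducing identity holds at every point, not merely almost everywhere, so it is an equality
   of functions and continuity transfers. *)
have <- : pairing f \o kernel_map evF Phi K = L0_fun (evB f).
  by apply/funext => x; exact: repr.
by move=> x; apply: continuous_comp; [exact: cK | exact: pairing_continuous].
Qed.
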